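(* Let $P$ be a doubly-stochastic $n\times n$ matrix, let $m$ be an integer with $1\le m\le n$, and let $t=\frac mn$. Then $$\mathrm{per}_m(P)\ \ge\ \frac{\left(\prod_{1\le i,j\le n}\left(1-\frac mn P(i,j)\right)^{1-\frac mn P(i,j)}\right) G(n)^{2(n-m)}}{\left(\frac mn\right)^m n^{-2n(1-t)}\big((n(1-t))!\big)^2}.$$
   Context: A doubly-stochastic matrix is an entrywise non-negative square matrix all of whose row and column sums equal $1$. $\mathrm{per}_m(P)=\sum_{|S|=|T|=m}\mathrm{per}(P_{S,T})$ is the sum of the permanents of all $m\times m$ submatrices. $G(x)=\left(\frac{x-1}{x}\right)^{x-1}$ for $x\ge 1$. Convention $0^0=1$. *)

(* Defs.v *)
From HB Require Import structures.
From mathcomp Require Import all_boot all_order all_algebra all_fingroup.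
From mathcomp Require Import reals exp.
Set Implicit Arguments. Unset Strict Implicit. Unset Printing Implicit Defensive.
Import Order.TTheory GRing.Theory Num.Theory.
Local Open Scope ring_scope.

Definition doubly_stochastic (R : realType) (n : nat) (P : 'M[R]_n) : Prop :=
  (forall i j, 0 <= P i j) /\
  (forall i, \sum_j P i j = 1) /\
  (forall j, \sum_i P i j = 1).

Definition per (R : realType) (k : nat) (A : 'M[R]_k) : R :=
  \sum_(s : 'S_k) \prod_(i < k) A i (s i).

(* the m x m submatrix P_{S,T}, rows of S and columns of T taken in increasing
   order (only meaningful when #|S| = #|T| = m, which is how it is used). *)
Definition submx (R : realType) (n m : nat) (A : 'M[R]_n)
  (S T : {set 'I_n}) : 'M[R]_m :=
  \matrix_(i < m, j < m)
     nth 0 [seq nth 0 [seq A r c | c <- enum T] j | r <- enum S] i.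

Definition per_m (R : realType) (n : nat) (m : nat) (A : 'M[R]_n) : R :=
  \sum_(S : {set 'I_n} | #|S| == m) \sum_(T : {set 'I_n} | #|T| == m)
     per (submx m A S T).

(* G(x) = ((x-1)/x)^(x-1); powR has 0 `^ 0 = 1 *)
Definition G (R : realType) (x : R) : R := ((x - 1) / x) `^ (x - 1).

(* Main.v *)
Require Import Defs.
From HB Require Import structures.
From mathcomp Require Import all_boot all_order all_algebra all_fingroup.
From mathcomp Require Import ring lra.
From mathcomp Require Import reals sequences exp.
Set Implicit Arguments. Unset Strict Implicit. Unset Printing Implicit Defensive.
Import Order.TTheory GRing.Theory Num.Theory.
Local Open Scope ring_scope.

(* Pad [t P] to the doubly stochastic matrix
     K = [[t P, J / n], [J^T / n, 0]]    of size 2 n - m,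
   J being the all-ones n x (n - m) matrix; then
     per K = n ^ (- 2 (n - m)) ((n - m)!) ^ 2 t ^ m per_m P,
   so the claim is the Bethe bound
     per A >= \prod_(i, j) (1 - A i j) ^ (1 - A i j)
   for the doubly stochastic matrix K.

   The Bethe bound is obtained by contracting edges one at a time (in the style
   of Anari and Oveis Gharan).  Attach variables u_e, v_e to the two ends of each
   edge e = (i, j) of the complete bipartite graph.  The product of the row sums
   \sum_j A i j u_ij and of the column sums \sum_i A i j v_ij is at least
   \prod_e (u_e v_e) ^ A_e by convexity.  Contracting e replaces a polynomial
   a + A b u_e + A c v_e + A^2 d u_e v_e by a + A d, which costs a factor
   (1 - A_e) ^ (1 - A_e) provided that b c <= a d.  The intermediate polynomials
   are partition functions of monomer-dimer models, for which b c <= a d says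
   that the events "row i is a monomer" and "column j is a monomer" are
   positively correlated.  After all the contractions only per A is left. *)

(** Double counting: a set with [k.+1] elements arises once from each of its elements [j]. In
    [md_const] this turns successive choices of columns into a factorial. *)
Lemma big_setU1_cards (V : nmodType) (T : finType) (A : {set T}) k
    (g : {set T} -> V) :
  \sum_(j in A)
    \sum_(D : {set T} | (D \subset A :\ j) && (#|D| == k)) g (j |: D) =
  (\sum_(D : {set T} | (D \subset A) && (#|D| == k.+1)) g D) *+ k.+1.
Proof.
rewrite -sumrMnl.
rewrite [RHS](eq_bigr (fun D : {set T} => \sum_(j in D) g D)); last first.
  by move=> D /andP[_ /eqP Dk]; rewrite sumr_const Dk.
rewrite [RHS](exchange_big_dep (mem A)) /=; last first.
  by move=> D j /andP[/subsetP DA _] /DA.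
apply: eq_bigr => j jA.
rewrite [RHS](reindex_onto (fun D : {set T} => j |: D)
  (fun D => D :\ j)) /=; last first.
  by move=> D /andP[_ jD]; rewrite setD1K.
apply: eq_bigl => D; rewrite setU11 andbT subsetD1 subUset sub1set jA /=.
case: (boolP (j \in D)) => jD; rewrite ?andbF ?andbT /=.
  apply/esym/negbTE; apply: contraTN jD => /andP[_ /eqP <-].
  by rewrite !inE eqxx.
by rewrite setU1K // eqxx andbT cardsU1 jD.
Qed.

(** * Expansions of the bipartite monomer-dimer partition function *)

Section MonomerDimer.
Variables (R : comNzRingType) (I J : finType).
Implicit Types (x : I -> R) (y : J -> R) (W : I -> J -> R).
Implicit Types (S : {set I}) (C : {set J}).

(* Partition function of the monomer-dimer model on the rows listed in [s] and
   the columns in [C]: every row [i] is either a monomer of weight [x i] or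
   matched to a column [j] with weight [W i j], and every column [j] left
   unmatched is a monomer of weight [y j]. *)
Fixpoint mdrec x y W (s : seq I) C : R :=
  if s is i :: s' then
    x i * mdrec x y W s' C + \sum_(j in C) W i j * mdrec x y W s' (C :\ j)
  else \prod_(j in C) y j.

Definition md x y W S C := mdrec x y W (enum S) C.

(** After unfolding two rows, the only term not visibly symmetric is a sum over ordered pairs of
    distinct columns, where the summations can be exchanged. Hence the order of the rows is
    immaterial and [md] may depend on a set of rows. *)
Lemma mdrec_swap x y W i k s C :
  mdrec x y W (i :: k :: s) C = mdrec x y W (k :: i :: s) C.
Proof.
have E a b : mdrec x y W (a :: b :: s) C = x a * (x b * mdrec x y W s C)
    + (\sum_(j in C) x a * (W b j * mdrec x y W s (C :\ j))
    + \sum_(j in C) x b * (W a j * mdrec x y W s (C :\ j)))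
    + \sum_(j in C) \sum_(l in C :\ j)
         W a j * (W b l * mdrec x y W s (C :\ j :\ l)).
  rewrite /= mulrDr mulr_sumr -!addrA.
  congr (_ + (_ + _)); rewrite -big_split /=; apply: eq_bigr => j _.
  by rewrite mulrDr mulrCA mulr_sumr.
rewrite !E; congr (_ + _ + _); rewrite 1?mulrCA 1?addrC //.
rewrite (exchange_big_dep (mem C)) /=; last first.
  by move=> j l _; rewrite inE => /andP[].
apply: eq_bigr => l lC; apply: eq_big => [j | j /andP[jC _]].
  by rewrite !inE lC andbT andbC eq_sym.
by rewrite mulrCA !setDDl setUC.
Qed.

Lemma mdrec_rem x y W i s C :
  i \in s -> mdrec x y W s C = mdrec x y W (i :: rem i s) C.
Proof.
elim: s C => // k s IHs C; rewrite inE /=.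
have [-> // | ki] := eqVneq k i; move=> /= si.
rewrite -[RHS]/(mdrec x y W (i :: k :: rem i s) C) mdrec_swap /= -/mdrec.
rewrite (IHs _ si); congr (_ + _).
by apply: eq_bigr => j _; rewrite (IHs _ si).
Qed.

Lemma mdrec_perm x y W s1 s2 C :
  perm_eq s1 s2 -> mdrec x y W s1 C = mdrec x y W s2 C.
Proof.
elim: s1 s2 C => [|i s1 IHs] s2 C p12.
  by have /nilP -> : nilp s2 by rewrite /nilp -(perm_size p12).
have i2 : i \in s2 by rewrite -(perm_mem p12) mem_head.
have p12' : perm_eq s1 (rem i s2).
  by rewrite -(perm_cons i) (perm_trans p12) ?perm_to_rem.
rewrite (mdrec_rem _ _ _ _ i2) /= (IHs _ _ p12'); congr (_ + _).
by apply: eq_bigr => j _; rewrite (IHs _ _ p12').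
Qed.

Lemma md_seq x y W s C : uniq s -> mdrec x y W s C = md x y W [set i in s] C.
Proof.
move=> us; apply: mdrec_perm; apply: uniq_perm; rewrite ?enum_uniq //.
by move=> i; rewrite mem_enum inE.
Qed.

Lemma md0 x y W C : md x y W set0 C = \prod_(j in C) y j.
Proof. by rewrite /md enum_set0. Qed.

Lemma md_row x y W S C i : i \in S ->
  md x y W S C = x i * md x y W (S :\ i) C
               + \sum_(j in C) W i j * md x y W (S :\ i) (C :\ j).
Proof.
move=> iS; rewrite {1}/md.
rewrite (@mdrec_perm _ _ _ _ (i :: enum (S :\ i))) //.
apply: uniq_perm; rewrite /= ?enum_uniq ?mem_enum ?inE ?eqxx //.
move=> k; rewrite inE !mem_enum !inE.
by case: eqVneq => [->|].
Qed.

(** The recursion eliminates rows only; this restores the symmetry with columns. Both sides are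
    expanded along one row [i], and the column expansion is applied to the remaining rows. *)
Lemma md_col x y W S C j : j \in C ->
  md x y W S C = y j * md x y W S (C :\ j)
               + \sum_(i in S) W i j * md x y W (S :\ i) (C :\ j).
Proof.
elim: {S}_.+1 {-2}S (ltnSn #|S|) C => // c IHc S leSc C jC.
have [-> | /set0Pn[i iS]] := eqVneq S set0.
  by rewrite !md0 big_set0 addr0 (big_setD1 j).
have ltSi : (#|S :\ i| < c)%N by rewrite (cardsD1 i) iS in leSc.
rewrite (md_row _ _ _ _ iS) (md_row _ _ _ (C :\ j) iS).
rewrite (IHc _ ltSi) // (big_setD1 j) // (big_setD1 i iS) /=.
rewrite [X in _ + (_ + X) = _](_ : _ = \sum_(l in C :\ j)
  (y j * (W i l * md x y W (S :\ i) (C :\ j :\ l)) + \sum_(k in S :\ i)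
     W k j * (W i l * md x y W (S :\ i :\ k) (C :\ j :\ l)))).
  rewrite big_split /= -mulr_sumr exchange_big /=.
  rewrite [X in _ = _ + (_ + X)](_ : _ = \sum_(k in S :\ i) (x i * (W k j *
    md x y W (S :\ i :\ k) (C :\ j)) + \sum_(l in C :\ j) W k j *
    (W i l * md x y W (S :\ i :\ k) (C :\ j :\ l)))).
    by rewrite big_split -mulr_sumr /=; ring.
  apply: eq_bigr => k; rewrite !inE => /andP[ki kS].
  have iSk : i \in S :\ k by rewrite !inE eq_sym ki.
  have -> : S :\ i :\ k = S :\ k :\ i by rewrite !setDDl setUC.
  by rewrite (md_row _ _ _ _ iSk) mulrDr mulrCA mulr_sumr.
apply: eq_bigr => l; rewrite !inE => /andP[lj lC].
have jCl : j \in C :\ l by rewrite !inE eq_sym lj.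
have -> : C :\ j :\ l = C :\ l :\ j by rewrite !setDDl setUC.
rewrite (IHc _ ltSi _ jCl) // mulrDr mulrCA mulr_sumr; congr (_ + _).
by apply: eq_bigr => k _; rewrite mulrCA.
Qed.

Lemma md_eq x x' y y' W W' S C :
  {in S, x =1 x'} -> {in C, y =1 y'} ->
  (forall i j, i \in S -> j \in C -> W i j = W' i j) ->
  md x y W S C = md x' y' W' S C.
Proof.
move=> xx' yy' WW'; rewrite /md.
have: {subset C <= C} by [].
have: {subset enum S <= S} by move=> i; rewrite mem_enum.
elim: (enum S) {1 3 4}C => [|i s IHs] D ssS sDC /=.
  by apply: eq_bigr => j /sDC; apply: yy'.
have iS : i \in S by apply: ssS; rewrite mem_head.
have {}ssS : {subset s <= S} by move=> k ks; apply: ssS; rewrite inE ks orbT.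
rewrite xx' // IHs //; congr (_ + _); apply: eq_bigr => j jD.
by rewrite WW' ?sDC // IHs // => k; rewrite inE => /andP[_ /sDC].
Qed.

Lemma md0r x y W S : md x y W S set0 = \prod_(i in S) x i.
Proof.
rewrite /md -big_enum /=; elim: (enum S) => [|i s IHs] /=.
  by rewrite big_set0 big_nil.
by rewrite big_set0 addr0 IHs big_cons.
Qed.

(** This lemma and the next two express that [md] is affine in each single weight, its slope being
    the partition function with the row, the column or both ends of the edge deleted. *)
Lemma md_dx x x' y W S C i : i \in S -> (forall k, k != i -> x' k = x k) ->
  md x' y W S C = md x y W S C + (x' i - x i) * md x y W (S :\ i) C.
Proof.
move=> iS xx'; rewrite !(md_row _ _ _ _ iS).
have E D : md x' y W (S :\ i) D = md x y W (S :\ i) D.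
  by apply: md_eq => // k; rewrite !inE => /andP[/xx'].
by under eq_bigr do rewrite E; rewrite E; ring.
Qed.

Lemma md_dy x y y' W S C j : j \in C -> (forall k, k != j -> y' k = y k) ->
  md x y' W S C = md x y W S C + (y' j - y j) * md x y W S (C :\ j).
Proof.
move=> jC yy'; rewrite !(md_col _ _ _ _ jC).
have E D : md x y' W D (C :\ j) = md x y W D (C :\ j).
  by apply: md_eq => // k; rewrite !inE => /andP[/yy'].
by under eq_bigr do rewrite E; rewrite E; ring.
Qed.

Lemma md_dW x y W W' S C i j : i \in S -> j \in C ->
  (forall k l, (k, l) != (i, j) -> W' k l = W k l) ->
  md x y W' S C = md x y W S C
                + (W' i j - W i j) * md x y W (S :\ i) (C :\ j).
Proof.
move=> iS jC WW'; rewrite !(md_row _ _ _ _ iS) !(big_setD1 j jC) /=.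
have E D : md x y W' (S :\ i) D = md x y W (S :\ i) D.
  apply: md_eq => // k l; rewrite !inE => /andP[ki _] _.
  by rewrite WW' // xpair_eqE negb_and ki.
rewrite !E (eq_bigr (fun l => W i l * md x y W (S :\ i) (C :\ l))).
  by ring.
move=> l; rewrite !inE => /andP[lj _].
by rewrite E WW' // xpair_eqE negb_and lj orbT.
Qed.

Lemma md_W0 x y S C :
  md x y (fun _ _ => 0) S C = (\prod_(i in S) x i) * \prod_(j in C) y j.
Proof.
rewrite /md -[X in _ = X * _]big_enum /=; elim: (enum S) => [|i s IHs] /=.
  by rewrite big_nil mul1r.
by rewrite big1 ?addr0 => [|j _]; rewrite ?mul0r // IHs big_cons mulrA.
Qed.

Lemma md_const b x y W S C (L : {set I}) (N : {set J}) :
  L \subset S -> {in L, x =1 fun=> 0} ->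
  (forall i j, i \in L -> j \in C -> W i j = b *+ (j \in N)) ->
  md x y W S C = b ^+ #|L| *+ #|L|`! *
    \sum_(D : {set J} | (D \subset C :&: N) && (#|D| == #|L|))
       md x y W (S :\: L) (C :\: D).
Proof.
move Ek: #|L| => k; elim: k L S C Ek => [|k IHk] L S C Lk LS xL WL.
  rewrite (cards0_eq Lk) setD0 expr0 mul1r (big_pred1 set0) ?setD0 // => D.
  by rewrite cards_eq0 andbC /=; case: eqVneq => // ->; rewrite sub0set.
have /set0Pn[i iL] : L != set0 by rewrite -cards_eq0 Lk.
have Lik : #|L :\ i| = k by move: Lk; rewrite (cardsD1 i) iL => -[].
have LiS : L :\ i \subset S :\ i by rewrite setSD.
have SLi : S :\ i :\: (L :\ i) = S :\: L.
  by rewrite setDDl setD1K.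
rewrite (md_row _ _ _ _ (subsetP LS i iL)) xL // mul0r add0r.
have fac V : b ^+ k.+1 *+ k.+1`! * V = b * (b ^+ k *+ k`!) * (V *+ k.+1).
  rewrite -(mulr_natr V) -(mulr_natr (_ ^+ k)) -mulr_natr factS natrM exprS.
  by move: (k`!%:R : R) (k.+1%:R : R) (b ^+ k) => f g c; ring.
rewrite fac -big_setU1_cards.
rewrite (big_setID N) /= addrC big1 ?add0r; last first.
  by move=> j; rewrite inE => /andP[/negPf jN jC]; rewrite WL // jN mul0r.
rewrite mulr_sumr; apply: eq_bigr => j.
rewrite inE => /andP[jC jN]; rewrite WL // jN (IHk (L :\ i)) //; last first.
- by move=> k1 l; rewrite !inE => /andP[_ kL] /andP[_ lC]; rewrite WL.
- by move=> l; rewrite inE => /andP[_ /xL].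
rewrite SLi mulr1n mulrA; congr (_ * _); apply: eq_big => [D | D _].
  by rewrite setIDAC.
by rewrite setDDl.
Qed.

End MonomerDimer.

Lemma md_tr (R : comNzRingType) (I J : finType) x y W
    (S : {set I}) (C : {set J}) :
  md x y W S C = md y x (fun j i => W i j) C S :> R.
Proof.
elim: {S}_.+1 {-2}S (ltnSn #|S|) C => // c IHc S leSc C.
have [-> | /set0Pn[i iS]] := eqVneq S set0; first by rewrite md0 md0r.
have ltSi : (#|S :\ i| < c)%N by rewrite (cardsD1 i) iS in leSc.
rewrite (md_row _ _ _ _ iS) (md_col _ _ _ _ iS) IHc //.
by congr (_ + _); apply: eq_bigr => j _; rewrite IHc.
Qed.

Lemma big_fst_eq (R : nmodType) (I J : finType) (F : I * J -> R) i :
  \sum_(e | e.1 == i) F e = \sum_j F (i, j).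
Proof.
rewrite (reindex_onto (fun j => (i, j)) snd) /=; last first.
  by move=> [k l] /= /eqP ->.
by apply: eq_bigl => j; rewrite !eqxx.
Qed.

Lemma big_snd_eq (R : nmodType) (I J : finType) (F : I * J -> R) j :
  \sum_(e | e.2 == j) F e = \sum_i F (i, j).
Proof.
rewrite (reindex_onto (fun i => (i, j)) fst) /=; last first.
  by move=> [k l] /= /eqP ->.
by apply: eq_bigl => i; rewrite !eqxx.
Qed.

(** * Correlation inequalities for monomers *)

Section Correlation.
Variables (R : realDomainType) (I J : finType).
Variables (x : I -> R) (y : J -> R) (W : I -> J -> R).
Hypotheses (x_ge0 : forall i, 0 <= x i) (y_ge0 : forall j, 0 <= y j).
Hypothesis W_ge0 : forall i j, 0 <= W i j.
Implicit Types (S : {set I}) (C : {set J}).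
Local Notation Z := (md x y W).

Lemma md_ge0 S C : 0 <= Z S C.
Proof.
rewrite /md; elim: (enum S) C => [|i s IHs] C /=; first exact: prodr_ge0.
by rewrite addr_ge0 ?mulr_ge0 ?sumr_ge0 // => j _; rewrite mulr_ge0.
Qed.

(** Expanding [Z S C] and [Z S (C :\ k)] along column [j], the monomer terms agree and the other
    terms compare one by one through the row-column inequality assumed for at most [#|S|] rows. *)
Lemma md_correlation_cols S C j k :
  (forall S' i, (#|S'| <= #|S|)%N -> i \in S' ->
     Z (S' :\ i) (C :\ j) * Z S' (C :\ j :\ k) <=
     Z S' (C :\ j) * Z (S' :\ i) (C :\ j :\ k)) ->
  j \in C -> k \in C -> j != k ->
  Z S C * Z S (C :\ j :\ k) <= Z S (C :\ j) * Z S (C :\ k).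
Proof.
move=> opp jC kC jk.
have jCk : j \in C :\ k by rewrite !inE jk.
have -> : Z S (C :\ k) = y j * Z S (C :\ j :\ k)
    + \sum_(l in S) W l j * Z (S :\ l) (C :\ j :\ k).
  by rewrite (md_col _ _ _ _ jCk) !setDDl (setUC [set j]).
rewrite (md_col _ _ _ _ jC) mulrDl mulrDr !mulr_suml mulr_sumr.
rewrite lerD //; first by rewrite mulrAC mulrC mulrA.
apply: ler_sum => i iS; rewrite mulrCA -mulrA ler_wpM2l //.
by apply: opp.
Qed.

(* Deleting a row and a column is positively correlated, while deleting two
   columns is negatively correlated: expanding along a row turns the first
   statement into the second on fewer rows, and expanding along a column turns
   the second into the first. *)
Lemma md_correlation S C i j : i \in S -> j \in C ->
  Z (S :\ i) C * Z S (C :\ j) <= Z S C * Z (S :\ i) (C :\ j).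
Proof.
elim: {S}_.+1 {-2}S (ltnSn #|S|) C i j => // c IHc S leSc C i j iS jC.
have ltSi : (#|S :\ i| < c)%N by rewrite (cardsD1 i) iS in leSc.
rewrite !(md_row _ _ _ _ iS) (big_setD1 j jC) /= mulrDl mulrDr.
rewrite lerD //; first by rewrite mulrCA mulrA.
(* Matching [i] to [j] gives a term on the right only, [W i j] times a square, which is dropped. *)
rewrite mulrDl mulr_suml mulr_sumr -[leLHS]add0r lerD //.
  by rewrite !mulr_ge0 ?md_ge0.
apply: ler_sum => k; rewrite !inE => /andP[kj kC].
rewrite mulrCA -mulrA ler_wpM2l // [leRHS]mulrC.
apply: md_correlation_cols; rewrite // 1?eq_sym // => S' l leS' lS'.
case: (boolP (k \in C :\ j)) => [kCj|]; last by rewrite !inE kj kC.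
by apply: IHc => //; apply: leq_ltn_trans leS' _.
Qed.

End Correlation.

(** * Cost of contracting one edge *)

Section Analysis.
Variable R : realType.

(** Weighted AM-GM in exponential form, from the tangent to [expR] at the mean [m]. *)
Lemma expR_sum_le (T : finType) (w s : T -> R) :
  (forall i, 0 <= w i) -> \sum_i w i = 1 ->
  expR (\sum_i w i * s i) <= \sum_i w i * expR (s i).
Proof.
move=> w0 w1; set m := \sum_i w i * s i.
have -> : expR m = \sum_i w i * (expR m * (1 + (s i - m))).
  under eq_bigr do rewrite mulrCA mulrDr mulr1 mulrBr.
  rewrite -mulr_sumr big_split sumrB /= -mulr_suml w1.
  by rewrite mul1r subrr addr0 mulr1.
apply: ler_sum => i _; rewrite ler_wpM2l //.
rewrite -[leRHS](_ : expR m * expR (s i - m) = _).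
  by rewrite ler_wpM2l ?expR_ge0 ?expR_ge1Dx.
by rewrite -expRD addrC subrK.
Qed.

(* At the optimal [s] and [t] the right-hand side of the hypothesis is at most
   [a / (1 - al) ^+ 2], and the conclusion is then weighted AM-GM between
   [a / (1 - al)] and [d]. *)
Lemma contract_edge_pos (al a b c d L : R) : 0 < al < 1 ->
  0 < a -> 0 <= b -> 0 <= c -> 0 < d -> b * c <= a * d ->
  (forall s t, L * expR (al * (s + t)) <=
     a + al * b * expR s + al * c * expR t + al ^+ 2 * d * expR (s + t)) ->
  L * (1 - al) `^ (1 - al) <= a + al * d.
Proof.
move=> /andP[al0 al1] a0 b0 c0 d0 bcad H.
have be0 : 0 < 1 - al by rewrite subr_gt0.
have aq : 0 < a / (1 - al) by rewrite divr_gt0.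
pose p := ln (a / (1 - al)); pose q := ln d; pose la := ln (1 - al).
have Ep : expR p = a / (1 - al) by rewrite lnK.
have Eq : expR q = d by rewrite lnK.
have Ela : expR la = 1 - al by rewrite lnK.
(* This sum makes [d * expR (s + t)] equal to [a / (1 - al) ^+ 2]. Then [b * c <= a * d] gives
   [b * c * expR (s + t) <= expR p ^+ 2], which leaves room to split the sum so that both middle
   terms are bounded by [expR p]. *)
have [s [t [Est Hs Ht]]] : exists s t, [/\ s + t = p - q - la,
    b * expR s <= expR p & c * expR t <= expR p].
  have key u v : 0 < u -> u * v <= a * d -> exists s t, [/\ s + t = p - q - la,
    u * expR s <= expR p & v * expR t <= expR p].
    move=> u0 uv; have Eu : expR (ln u) = u by rewrite lnK.
    exists (p - ln u), (ln u - q - la); split; first by ring.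
      by rewrite expRB Eu mulrC divfK ?gt_eqF.
    rewrite !expRB Eu Ela Eq Ep mulrA ler_pM2r ?invr_gt0 //.
    by rewrite mulrA ler_pdivrMr // mulrC.
  have [b1|b1] := ltP 0 b; first exact: key.
  have [c1|c1] := ltP 0 c.
    have [|s [t [E ? ?]]] := key c b c1; first by rewrite mulrC.
    by exists t, s; rewrite addrC.
  have -> : b = 0 by apply/le_anti/andP.
  have -> : c = 0 by apply/le_anti/andP.
  by exists (p - q - la), 0; rewrite !mul0r addr0 expR_ge0.
have Est' : d * expR (s + t) = expR p / (1 - al).
  by rewrite Est !expRB Eq Ela; field; rewrite !gt_eqF.
have H1 : L * expR (al * (s + t)) <= expR p / (1 - al).
  apply: le_trans (H s t) _.
  have -> : expR p / (1 - al) =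
      a + al * expR p + al * expR p + al ^+ 2 * (expR p / (1 - al)).
    by rewrite Ep; field; rewrite gt_eqF.
  rewrite -!mulrA Est' !lerD // ler_wpM2l // ltW //.
have -> : (1 - al) `^ (1 - al) = expR ((1 - al) * la).
  by rewrite /powR gt_eqF.
have -> : a + al * d = (1 - al) * expR p + al * expR q.
  by rewrite Ep Eq; field; rewrite gt_eqF.
have := @expR_sum_le bool (fun i => if i then 1 - al else al)
  (fun i => if i then p else q).
rewrite !big_bool /= subrK => /(_ _ erefl) H2.
apply: le_trans (H2 _); last by case; apply: ltW.
rewrite -(ler_pM2r (expR_gt0 (al * (s + t) - (1 - al) * la))) -mulrA -!expRD.
rewrite [X in L * expR X]addrC subrK; apply: le_trans H1 _.
rewrite -[X in _ / X]Ela -expRB ler_expR Est.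
by rewrite le_eqVlt; apply/orP; left; apply/eqP; ring.
Qed.

Lemma contract_edge (al a b c d L : R) : 0 <= al <= 1 ->
  0 <= a -> 0 <= b -> 0 <= c -> 0 <= d -> b * c <= a * d ->
  (forall s t, L * expR (al * (s + t)) <=
     a + al * b * expR s + al * c * expR t + al ^+ 2 * d * expR (s + t)) ->
  L * (1 - al) `^ (1 - al) <= a + al * d.
Proof.
move=> /andP[]; rewrite le_eqVlt => /orP[/eqP <- _ | al0].
  move=> _ _ _ _ _ /(_ 0 0).
  by rewrite !(mul0r, expr0n, addr0, subr0, expR0, mulr1, powRr1).
rewrite le_eqVlt => /orP[/eqP -> | al1] a0 b0 c0 d0 bcad H.
  rewrite subrr powRr0 mulr1 mul1r leNgt; apply/negP => lt_adL.
  have Ld : 0 < L - d by lra.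
  have q0 : 0 <= (a + b + c) / (L - d).
    by rewrite divr_ge0 ?(ltW Ld) // !addr_ge0.
  pose K := 1 + (a + b + c) / (L - d).
  have K1 : 1 <= K by rewrite /K lerDl.
  have EK : expR (ln K) = K by rewrite lnK // posrE (lt_le_trans ltr01).
  have := H (ln K) (ln K); rewrite !mul1r expRD EK expr1n mul1r.
  have EKL : K * (L - d) = (L - d) + (a + b + c).
    by rewrite /K; field; rewrite gt_eqF.
  nra.
(* Perturbing [a] and [d] makes them positive. *)
apply/ler_addgt0Pr => e e0.
have e'0 : 0 < e / (1 + al) by rewrite divr_gt0 // addr_gt0.
set e' := e / (1 + al) in e'0.
have -> : a + al * d + e = (a + e') + al * (d + e').
  by rewrite /e'; field; rewrite gt_eqF // addr_gt0.
apply: (@contract_edge_pos _ _ b c); rewrite ?al0 //; [lra| lra | |].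
  by apply: le_trans bcad _; rewrite ler_pM //; lra.
move=> s t; apply: le_trans (H s t) _; rewrite !mulrDr mulrDl addrA.
have : 0 <= al ^+ 2 * e' * expR (s + t).
  by rewrite mulr_ge0 ?expR_ge0 // mulr_ge0 ?sqr_ge0 // ltW.
lra.
Qed.


(** * Contraction of all edges and the Bethe bound *)

Variables (I J : finType).

(** Induction on the list [l] of edges not yet contracted: [W] collects the weights of the
    contracted ones and [L] their costs. The positive variables at the ends of an edge are written
    as exponentials of [u e] and [v e]. *)
Lemma contract_edges (al : I * J -> R) (l : seq (I * J)) L
    (x : I -> R) (y : J -> R) W :
  uniq l -> (forall e, 0 <= al e <= 1) ->
  (forall i, 0 <= x i) -> (forall j, 0 <= y j) -> (forall i j, 0 <= W i j) ->
  (forall u v : I * J -> R, L * expR (\sum_(e <- l) al e * (u e + v e)) <=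
     md (fun i => x i + \sum_(e <- l | e.1 == i) al e * expR (u e))
        (fun j => y j + \sum_(e <- l | e.2 == j) al e * expR (v e))
        W setT setT) ->
  L * \prod_(e <- l) (1 - al e) `^ (1 - al e) <=
    md x y (fun i j => W i j + \sum_(e <- l | e == (i, j)) al e) setT setT.
Proof.
move=> + al01 x0 y0; have al0 e : 0 <= al e by case/andP: (al01 e).
elim: l L W => [|e l IHl] L W /=.
  move=> _ _ H; have := H (fun=> 0) (fun=> 0); rewrite !big_nil expR0.
  rewrite (@md_eq _ _ _ _ x _ y _ W).
  - by rewrite [X in _ -> _ <= X](@md_eq _ _ _ _ x _ y _ W) // => *;
      rewrite big_nil addr0.
  - by move=> *; rewrite big_nil addr0.
  - by move=> *; rewrite big_nil addr0.
  - by [].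
move=> /andP[el ul] W0 H.
pose W1 i j := W i j + (if e == (i, j) then al e else 0).
rewrite (@md_eq _ _ _ x x y y _
  (fun i j => W1 i j + \sum_(e <- l | e == (i, j)) al e)) //; last first.
  move=> i j _ _; rewrite big_cons /W1.
  by case: ifP; rewrite ?addr0 ?addrA.
rewrite big_cons mulrA; apply: IHl => // [i j | u v].
  by rewrite addr_ge0 //; case: ifP.
pose x' i := x i + \sum_(e <- l | e.1 == i) al e * expR (u e).
pose y' j := y j + \sum_(e <- l | e.2 == j) al e * expR (v e).
have x'0 i : 0 <= x' i.
  by rewrite addr_ge0 ?sumr_ge0 // => *; rewrite mulr_ge0 ?expR_ge0.
have y'0 i : 0 <= y' i.
  by rewrite addr_ge0 ?sumr_ge0 // => *; rewrite mulr_ge0 ?expR_ge0.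
have -> : md x' y' W1 setT setT =
    md x' y' W setT setT + al e * md x' y' W (setT :\ e.1) (setT :\ e.2).
  rewrite (@md_dW _ _ _ _ _ W _ _ _ e.1 e.2) ?inE //; last first.
    move=> k k' /negPf; rewrite -surjective_pairing /W1 eq_sym => ->.
    by rewrite addr0.
  by rewrite /W1 -surjective_pairing eqxx; congr (_ + _ * _); ring.
rewrite mulrAC; apply: (@contract_edge _ _ (md x' y' W (setT :\ e.1) setT)
  (md x' y' W setT (setT :\ e.2))); rewrite ?md_ge0 //.
  by apply: md_correlation.
move=> s t.
(* As [e] is not in [l], its two variables can be set to [s] and [t] without disturbing the others;
   [md_dx] and [md_dy] then split off the four terms of [contract_edge]. *)
pose upd (f : I * J -> R) r e' := if e' == e then r else f e'.
have updl f r e' : e' \in l -> upd f r e' = f e'.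
  by rewrite /upd; case: eqP => // -> el'; rewrite el' in el.
have := H (upd u s) (upd v t).
rewrite !big_cons {1 2}/upd eqxx.
rewrite (eq_big_seq (fun e => al e * (u e + v e))); last first.
  by move=> e' e'l; rewrite !updl.
rewrite addrC expRD mulrA => /le_trans; apply.
set xx := (X in md X _ _ _ _); set yy := (X in md _ X _ _ _).
have Exx i : xx i = x' i + (if e.1 == i then al e * expR s else 0).
  rewrite /xx big_cons /x' -addrA; congr (_ + _).
  have -> : \sum_(e0 <- l | e0.1 == i) al e0 * expR (upd u s e0) =
            \sum_(e0 <- l | e0.1 == i) al e0 * expR (u e0).
    rewrite big_seq_cond [RHS]big_seq_cond.
    by apply: eq_bigr => e' /andP[/updl ->].
  by rewrite /upd eqxx; case: ifP; rewrite ?addr0 // addrC.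
have Eyy i : yy i = y' i + (if e.2 == i then al e * expR t else 0).
  rewrite /yy big_cons /y' -addrA; congr (_ + _).
  have -> : \sum_(e0 <- l | e0.2 == i) al e0 * expR (upd v t e0) =
            \sum_(e0 <- l | e0.2 == i) al e0 * expR (v e0).
    rewrite big_seq_cond [RHS]big_seq_cond.
    by apply: eq_bigr => e' /andP[/updl ->].
  by rewrite /upd eqxx; case: ifP; rewrite ?addr0 // addrC.
rewrite (@md_dx _ _ _ x' _ _ _ _ _ e.1) ?inE //; last first.
  by move=> k /negPf ke; rewrite Exx eq_sym ke addr0.
have Ey S : md x' yy W S setT =
    md x' y' W S setT + al e * expR t * md x' y' W S (setT :\ e.2).
  rewrite (@md_dy _ _ _ _ y' _ _ _ _ e.2) ?inE //; last first.
    by move=> k /negPf ke; rewrite Eyy eq_sym ke addr0.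
  by rewrite Eyy eqxx; congr (_ + _ * _); ring.
rewrite !Ey Exx eqxx expRD.
by rewrite le_eqVlt; apply/orP; left; apply/eqP; ring.
Qed.

(** With zero monomer weights only perfect matchings survive, so [md] is the permanent. In this form
    the bound applies directly to a matrix indexed by a sum type. *)
Lemma permanent_bethe (A : I -> J -> R) :
  (forall i j, 0 <= A i j) ->
  (forall i, \sum_j A i j = 1) -> (forall j, \sum_i A i j = 1) ->
  \prod_i \prod_j (1 - A i j) `^ (1 - A i j) <=
    md (fun=> 0) (fun=> 0) A setT setT.
Proof.
move=> A0 Ar Ac; pose al (e : I * J) := A e.1 e.2.
have al01 e : 0 <= al e <= 1.
  by rewrite A0 -(Ar e.1) (bigD1 e.2) //= lerDl sumr_ge0.
have := @contract_edges al (index_enum _) 1 (fun=> 0) (fun=> 0) (fun _ _ => 0)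
  (index_enum_uniq _) al01.
set F := \prod_i _.
have -> : \prod_(e <- index_enum _) (1 - al e) `^ (1 - al e) = F.
  by rewrite -(pair_bigA _ (fun i j => (1 - A i j) `^ (1 - A i j))).
rewrite mul1r (@md_eq _ _ _ _ (fun=> 0) _ (fun=> 0) _ A) //; last first.
  by move=> i j _ _; rewrite big_pred1_eq add0r.
apply=> // u v; rewrite mul1r md_W0.
have -> : \sum_e al e * (u e + v e) = \sum_e al e * u e + \sum_e al e * v e.
  by rewrite -big_split; apply: eq_bigr => e _; rewrite mulrDr.
rewrite expRD ler_pM ?expR_ge0 //.
  have -> : \sum_e al e * u e = \sum_i \sum_j A i j * u (i, j).
    by rewrite pair_bigA; apply: eq_bigr => -[].
  rewrite expR_sum.
  rewrite [leRHS](eq_bigl predT) => [|i]; last by rewrite inE.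
  apply: ler_prod => i _; rewrite expR_ge0 add0r big_fst_eq /=.
  exact: expR_sum_le.
have -> : \sum_e al e * v e = \sum_j \sum_i A i j * v (i, j).
  by rewrite exchange_big pair_bigA; apply: eq_bigr => -[].
rewrite expR_sum.
rewrite [leRHS](eq_bigl predT) => [|j]; last by rewrite inE.
apply: ler_prod => j _; rewrite expR_ge0 add0r big_snd_eq /=.
exact: expR_sum_le.
Qed.

End Analysis.

(** * Permanents as partition functions without monomers *)

Section Permanent.
Variable R : realType.

(** A permutation amounts to the image of [ord0] together with a permutation of the rest, through
    [lift_perm]. *)
Lemma per_row n (A : 'M[R]_n.+1) :
  per A = \sum_j A ord0 j * per (row' ord0 (col' j A)).
Proof.
pose f (js : 'I_n.+1 * 'S_n) := lift_perm ord0 js.1 js.2.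
have f_inj : injective f.
  move=> [j s] [k u] /permP E.
  have /= := E ord0; rewrite !lift_perm_id /= => jk.
  rewrite -jk; congr (_, _); apply/permP => i; apply: (@lift_inj _ j).
  by have /= := E (lift ord0 i); rewrite !lift_perm_lift /= -jk.
have f_bij : bijective f.
  by apply: inj_card_bij => //; rewrite card_prod card_ord !card_Sn factS.
rewrite {1}/per (reindex f) /=; last exact: onW_bij.
under [RHS]eq_bigr do rewrite mulr_sumr.
rewrite pair_big; apply: eq_bigr => -[j s] _ /=.
rewrite big_ord_recl lift_perm_id; congr (_ * _).
by apply: eq_bigr => i _; rewrite lift_perm_lift !mxE.
Qed.

Lemma per_scale n a (A : 'M[R]_n) : per (a *: A) = a ^+ n * per A.
Proof.
rewrite /per mulr_sumr; apply: eq_bigr => s _.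
under eq_bigr do rewrite mxE.
by rewrite big_split /= prodr_const card_ord.
Qed.

Lemma mdrec_per (I J : finType) (W : I -> J -> R) r0 c0
    (r : seq I) (c : seq J) m :
  size r = m -> size c = m -> uniq c ->
  mdrec (fun=> 0) (fun=> 0) W r [set j in c] =
  per (\matrix_(i < m, j < m) W (nth r0 r i) (nth c0 c j)).
Proof.
elim: r c m => [|i r IHr] c [|m] //=.
  move=> _ /size0nil -> _; rewrite /per (big_pred1 1%g) ?big_ord0 => [|s].
    by rewrite big1 // => j; rewrite inE.
  by apply/esym/eqP/permP => -[].
move=> [rm] cm uc; rewrite mul0r add0r per_row.
under eq_bigl do rewrite inE.
rewrite -big_uniq //= (big_nth c0) big_mkord cm; apply: eq_bigr => k _.
rewrite !mxE /=; congr (_ * _).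
have kc : (k < size c)%N by rewrite cm.
have -> : [set j in c] :\ nth c0 c k = [set j in rem (nth c0 c k) c].
  by apply/setP => j; rewrite !inE mem_rem_uniq // inE.
rewrite (IHr _ m) ?rem_uniq ?size_rem ?mem_nth ?cm //.
congr per; apply/matrixP => i' j'; rewrite !mxE /=; congr (W _ _).
(* Removing the [k]-th column from the list shifts the later positions by one, as [bump] does in
   [col']. *)
rewrite remE index_uniq // nth_cat size_take kc /bump.
case: ltnP => jk /=; last by rewrite nth_drop addSn subnKC.
by rewrite nth_take.
Qed.

End Permanent.

(** * The padded matrix and its permanent *)

Section Padding.
Variables (R : realType) (n k : nat).
Let T : finType := ('I_n + 'I_k)%type.
Let A : {set T} := [set inl i | i : 'I_n].

Lemma inl_injective : injective (inl : 'I_n -> T).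
Proof. by move=> ? ? []. Qed.

Lemma inl_range i : inl i \in A.
Proof. by rewrite mem_imset //; apply: inl_injective. Qed.

Lemma inr_imset (i : 'I_k) (B : {pred 'I_n}) :
  (inr i \in (inl @: B : {set T})) = false.
Proof. by apply/imsetP => -[]. Qed.

(** [D] stands for the original indices consumed by the padding, and its complement [C] for those
    left to the submatrix. *)
Lemma big_sub_inl (V : nmodType) m (g : {set T} -> V) : (m + k = n)%N ->
  \sum_(D : {set T} | (D \subset A) && (#|D| == k)) g D =
  \sum_(C : {set 'I_n} | #|C| == m) g (inl @: (~: C)).
Proof.
move=> mk.
have injl := inl_injective.
rewrite (reindex_onto (fun C : {set 'I_n} => inl @: (~: C) : {set T})
   (fun D => ~: (inl @^-1: D))) /=; last first.
  move=> D /andP[/subsetP DA _]; apply/setP => a; rewrite setCK.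
  apply/imsetP/idP => [[i + ->] | aD]; first by rewrite inE.
  by have /imsetP[i _ E] := DA a aD; exists i; rewrite // inE -E.
apply: eq_bigl => C; rewrite card_imset // imsetS /=; last exact/subsetP.
have -> : inl @^-1: (inl @: (~: C) : {set T}) = ~: C.
  by apply/setP => i; rewrite inE mem_imset.
rewrite setCK eqxx andbT -(eqn_add2l #|C|) cardsC card_ord.
by move: #|C| => q; rewrite -[X in X == _]mk eqn_add2r eq_sym.
Qed.

Lemma setD_inl (C : {set 'I_n}) :
  setT :\: (inl @: (~: C) : {set T}) :\: (~: A) = inl @: C.
Proof.
apply/setP => -[i|i]; rewrite !inE ?andbT.
  rewrite !mem_imset ?inE ?negbK //; by move=> ? ? [].
by rewrite !inr_imset.
Qed.

Definition padding (P : 'M[R]_n) (t b : R) (a c : T) : R :=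
  match a, c with
  | inl i, inl j => t * P i j
  | inr _, inr _ => 0
  | _, _ => b
  end.

Lemma md_padding_inl P t b m (S C : {set 'I_n}) : #|S| = m -> #|C| = m ->
  md (fun=> 0) (fun=> 0) (padding P t b) (inl @: S) (inl @: C) =
  t ^+ m * per (Defs.submx m P S C).
Proof.
(* When [m = 0] there may be no index to serve as a default element in [mdrec_per]. *)
move=> Sm Cm; case: m Sm Cm => [|m] Sm Cm.
  rewrite (cards0_eq Sm) (cards0_eq Cm) !imset0 md0 big_set0 mul1r.
  rewrite /per (big_pred1 1%g) ?big_ord0 // => s.
  by apply/esym/eqP/permP => -[].
have /set0Pn[r0 _] : S != set0 by rewrite -cards_eq0 Sm.
have injl := inl_injective.
have E (B : {set 'I_n}) : inl @: B = [set a : T in map inl (enum B)].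
  apply/setP => a; rewrite !inE.
  apply/imsetP/mapP => -[i iB ->]; exists i => //.
    by rewrite mem_enum.
  by rewrite -mem_enum.
rewrite !E -md_seq ?map_inj_uniq ?enum_uniq //.
rewrite (mdrec_per _ (inl r0) (inl r0) (m := m.+1)) ?map_inj_uniq ?enum_uniq //.
- rewrite -per_scale; congr per; apply/matrixP => i j.
  have iS : (i < size (enum S))%N by rewrite -cardE Sm.
  have jC : (j < size (enum C))%N by rewrite -cardE Cm.
  by rewrite !mxE !(nth_map r0).
- by rewrite size_map -cardE.
- by rewrite size_map -cardE.
Qed.

Lemma md_padding P t b m : (m + k = n)%N ->
  md (fun=> 0) (fun=> 0) (padding P t b) setT setT =
  (b ^+ k *+ k`!) ^+ 2 * t ^+ m * per_m m P.
Proof.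
move=> mk.
have injl := inl_injective.
have cA : #|~: A| = k.
  have := cardsC A; rewrite card_imset // card_sum !card_ord.
  by move/eqP; rewrite eqn_add2l => /eqP.
rewrite (@md_const _ _ _ b _ _ _ _ _ (~: A) A) ?subsetT //; last first.
  by move=> [i|i] [j|j]; rewrite !inE ?inl_range ?inr_imset.
rewrite cA setTI (big_sub_inl _ mk) expr2 -!mulrA; congr (_ * _).
rewrite /per_m exchange_big /= !mulr_sumr; apply: eq_bigr => C /eqP Cm.
rewrite md_tr (@md_const _ _ _ b _ _ _ _ _ (~: A) A) //; last 2 first.
- by apply/subsetP => -[i|i]; rewrite !inE ?inl_range ?inr_imset.
- by move=> [i|i] [j|j]; rewrite !inE ?inl_range ?inr_imset.
have TA : setT :\: ~: A = A by rewrite setTD setCK.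
rewrite cA {1}TA setIid (big_sub_inl _ mk); congr (_ * _).
rewrite mulr_sumr; apply: eq_bigr => S /eqP Sm.
rewrite md_tr setD_inl -(md_padding_inl _ _ b Sm Cm) -(setD_inl S).
by rewrite !setDDl (setUC (~: A)).
Qed.

End Padding.

(** * Evaluation of the Bethe product for the padded matrix *)

Theorem theorem6p4 (R : realType) (n m : nat) (P : 'M[R]_n)
  (hP : doubly_stochastic P) (hm1 : (1 <= m)%N) (hmn : (m <= n)%N) :
  let t : R := m%:R / n%:R in
  (\prod_(i < n) \prod_(j < n) (1 - t * P i j) `^ (1 - t * P i j))
    * G (n%:R : R) ^+ (2 * (n - m))
  / (t ^+ m * (n%:R : R) `^ (- (2 * n%:R * (1 - t))) * ((n - m)`!)%:R ^+ 2)
  <= per_m m P.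
Proof.
cbv zeta; set t : R := m%:R / n%:R; have [P0 [Pr Pc]] := hP.
have [k mk] : exists k, (m + k = n)%N by exists (n - m)%N; rewrite subnKC.
have -> : (n - m)%N = k by move/(congr1 (subn^~ m)): mk; rewrite addKn.
have n0 : 0 < n%:R :> R by rewrite ltr0n (leq_trans hm1).
have nE : n%:R = m%:R + k%:R :> R by rewrite -natrD mk.
have t0 : 0 < t by rewrite divr_gt0 // ltr0n.
pose b : R := n%:R^-1.
have b0 : 0 <= b by rewrite invr_ge0 ltW.
have tkb : t + k%:R * b = 1.
  by rewrite /t /b -mulrDl -nE divff ?gt_eqF.
have nb : n%:R * b = 1 by rewrite divff ?gt_eqF.
have := @permanent_bethe R _ _ (@padding R n k P t b).
rewrite (md_padding P t b mk) => bethe.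
have row_sum (i : 'I_n + 'I_k) : \sum_j padding P t b i j = 1.
  case: i => i; rewrite big_sumType /= sumr_const card_ord.
    by rewrite -mulr_sumr Pr mulr1 -(mulr_natl b k).
  by rewrite sumr_const mul0rn addr0 -(mulr_natl b n).
have col_sum (j : 'I_n + 'I_k) : \sum_i padding P t b i j = 1.
  case: j => j; rewrite big_sumType /= sumr_const card_ord.
    by rewrite -mulr_sumr Pc mulr1 -(mulr_natl b k).
  by rewrite sumr_const mul0rn addr0 -(mulr_natl b n).
have {}bethe := bethe _ row_sum col_sum; move: bethe.
set F := \prod_i \prod_j _.
set X := \prod_(i < n) _ => bethe.
(* So [n] entries equal to [b = 1 / n] contribute exactly one factor [G n]. *)
have GE : G (n%:R : R) = ((1 - b) `^ (1 - b)) ^+ n.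
  rewrite /G -powR_mulrn ?powR_ge0 // -powRrM.
  have -> : (1 - b) * n%:R = n%:R - 1 by rewrite mulrBl mul1r (mulrC b) nb.
  by rewrite mulrBl mul1r divff ?gt_eqF.
(* The block [t P] gives [X], the [k] padding rows and [k] padding columns give one [G n] each, and
   the zero block gives 1. *)
have FE : F = X * G (n%:R : R) ^+ (2 * k).
  rewrite /F big_sumType /= GE -exprM.
  under eq_bigr do rewrite big_sumType /= prodr_const card_ord.
  rewrite big_split /= prodr_const card_ord -/X -mulrA; congr (_ * _).
  under eq_bigr do rewrite big_sumType /= !prodr_const !card_ord.
  rewrite prodr_const card_ord subr0 powR1 expr1n mulr1 -!exprM -exprD.
  by congr (_ ^+ _); ring.
have nkE : (n%:R : R) `^ (- (2 * n%:R * (1 - t))) = b ^+ (2 * k).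
  have -> : 2 * n%:R * (1 - t) = (2 * k)%:R :> R.
    have -> : 1 - t = k%:R * b by apply/eqP; rewrite subr_eq addrC tkb.
    by rewrite mulrACA nb mulr1 natrM.
  by rewrite powR_invn ?ltW // exprVn.
rewrite nkE ler_pdivrMr.
  rewrite -FE mulrC; apply: le_trans (bethe _) _.
  - by move=> [i|i] [j|j] //=; rewrite mulr_ge0 // ltW.
  rewrite le_eqVlt; apply/orP; left; apply/eqP.
  rewrite (mulnC 2%N) exprM -(mulr_natr (b ^+ k)).
  by move: (_%:R : R) (b ^+ k) (t ^+ m) => f c d; ring.
by rewrite !mulr_gt0 ?exprn_gt0 ?ltr0n ?fact_gt0 // invr_gt0.
Qed.
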